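(* Fix $\lambda_1,\lambda_2>0$ and prices $p_1>p_2>0$, and write $\lambda_{1,2}=\lambda_1+\lambda_2$. For each $\beta\in(\lambda_1,\lambda_{1,2})$ there exists a finite positive constant $\hat\rho_\beta$ such that the regret of the $\beta$-LT policy satisfies $\rho_\beta(n,n/\alpha)\le\hat\rho_\beta$ for every $n\in\mathbb{N}$ and every real $\alpha>0$. (The constant may depend on $\beta,\lambda_1,\lambda_2,p_1,p_2$ but not on $n$ or $\alpha$.)
   Context: Time $t$ denotes the time remaining, so it runs downward from $t=T$ (start) to $t=0$ (end). Offline customers (price $p_1$) and online customers (price $p_2$, $0<p_2<p_1$) arrive over the horizon according to independent Poisson processes with rates $\lambda_1>0$ and $\lambda_2>0$; each customer requests one unit. $N_{j,T}(t)$ is the number of arrivals of type $j$ ($1$ = offline, $2$ = online) from the start (time $T$) until the moment when $t$ time units remain. The retailer starts at $t=T$ with $n\in\mathbb{N}$ units, with no replenishment and no salvage value. Each customer must be immediately and irrevocably accepted (one unit is used, the price is collected) or rejected; all customers are rejected once inventory is $0$. $\mathbb{N}$ denotes the positive integers. $\beta$-LT policy (linear threshold with slope $\beta$): while inventory is positive, every offline customer is accepted, and an online customer arriving with $t$ time units remaining is accepted if and only if the remaining inventory at that time (just before the acceptance decision) is at least $\beta t$. Hindsight-optimal solution for a realization: sell $m_1=\min\{n,N_{1,T}(0)\}$ units to offline customers and $\min\{n-m_1,N_{2,T}(0)\}$ units to online customers. The regret $\rho_\beta(n,T)$ is the expected value of (hindsight-optimal revenue) minus (revenue of the $\beta$-LT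 policy) with initial inventory $n$ and horizon length $T$. *)

(* Defs.v *)
From HB Require Import structures.
From mathcomp Require Import all_boot all_order all_algebra.
From mathcomp Require Import all_classical all_reals all_analysis.

Set Implicit Arguments.
Unset Strict Implicit.
Unset Printing Implicit Defensive.

Import Order.TTheory GRing.Theory Num.Theory.
Import numFieldNormedType.Exports.

Local Open Scope classical_set_scope.
Local Open Scope ring_scope.

(* [N u w] is the number of arrivals in the first [u] units of elapsed time.
   Over a horizon of length [T], the number of arrivals from the start until
   [t] time units remain is [N (T - t) w], and the total is [N T w]. *)

Section Processes.
Context {d : measure_display} {Omega : measurableType d} {R : realType}.
Variable P : probability Omega R.
Implicit Types N : R -> Omega -> nat.

(* The natural-number subtractions below are never truncated, because the
   paths are nondecreasing.  Right-continuity is for the discrete topology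
   of [nat]. *)
Record poisson_process (lambda : R) N : Prop := PoissonProcess {
  pp_measurable : forall u : R, 0 <= u -> measurable_fun setT (N u) ;
  pp_start : forall w, N 0 w = 0%N ;
  pp_nondecreasing : forall w (u v : R), 0 <= u -> u <= v -> (N u w <= N v w)%N ;
  pp_right_continuous : forall w (u : R), 0 <= u -> N v w @[v --> u^'+] --> N u w ;
  pp_independent_increments :
    forall (m : nat) (t : nat -> R) (A : nat -> set nat),
      0 <= t 0%N -> (forall i, (i < m)%N -> t i <= t i.+1) ->
      P (\bigcap_(i < m) [set w | A i (N (t i.+1) w - N (t i) w)%N]) =
      (\prod_(i < m) P [set w | A i (N (t i.+1) w - N (t i) w)%N])%E ;
  pp_poisson_increments : forall (u v : R) (k : nat), 0 <= u -> u < v ->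
      P [set w | (N v w - N u w)%N = k] =
      (poisson_pmf (lambda * (v - u)) k)%:E }.

Definition process_sigma_algebra N : set (set Omega) :=
  <<s [set E | exists (u : R) (A : set nat), 0 <= u /\ E = N u @^-1` A] >>.

Definition independent_processes N1 N2 : Prop :=
  forall E1 E2, process_sigma_algebra N1 E1 -> process_sigma_algebra N2 E2 ->
    P (E1 `&` E2) = (P E1 * P E2)%E.

End Processes.

Section Retailer.
Context {Omega : Type} {R : realType}.
Implicit Types (N : R -> Omega -> nat) (T p beta : R) (n : nat).

(* Elapsed time of the [k]-th arrival, counting from [k = 0]; meaningful only
   when the path has more than [k] arrivals. *)
Definition arrival_time N (k : nat) (w : Omega) : R :=
  inf [set u | 0 <= u /\ (k < N u w)%N].

(* A customer is a pair (offline?, time remaining at arrival). *)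
Definition customer : Type := (bool * R)%type.

Definition customers_of (offline : bool) N T w : seq customer :=
  [seq (offline, T - arrival_time N k w) | k <- iota 0 (N T w)].

(* In order of arrival, that is, by decreasing time remaining.  Simultaneous
   arrivals of the two types have probability zero; the (stable) sort puts the
   offline ones first. *)
Definition customers N1 N2 T w : seq customer :=
  sort (fun x y : customer => y.2 <= x.2)
       (customers_of true N1 T w ++ customers_of false N2 T w).

Definition lt_accepts beta (inv : nat) (c : customer) : bool :=
  (0 < inv)%N && (c.1 || (beta * c.2 <= inv%:R)).

Fixpoint lt_revenue p1 p2 beta (inv : nat) (s : seq customer) : R :=
  if s is c :: s' then
    if lt_accepts beta inv c
    then (if c.1 then p1 else p2) + lt_revenue p1 p2 beta inv.-1 s'
    else lt_revenue p1 p2 beta inv s'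
  else 0.

Definition hindsight_revenue p1 p2 n N1 N2 T w : R :=
  let m1 := minn n (N1 T w) in
  let m2 := minn (n - m1) (N2 T w) in
  p1 * m1%:R + p2 * m2%:R.

End Retailer.

Definition regret {d : measure_display} {Omega : measurableType d}
    {R : realType} (P : probability Omega R) (N1 N2 : R -> Omega -> nat)
    (p1 p2 beta : R) (n : nat) (T : R) : \bar R :=
  ('E_P[fun w => (hindsight_revenue p1 p2 n N1 N2 T w
                  - lt_revenue p1 p2 beta n (customers N1 N2 T w))%R])%E.

(* Main.v *)
Require Import Defs.
From HB Require Import structures.
From mathcomp Require Import all_boot all_order all_algebra.
From mathcomp Require Import all_classical all_reals all_analysis.
From mathcomp Require Import measurable_realfun.
From mathcomp Require Import zify lra ring.

Import Order.TTheory GRing.Theory Num.Theory.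
Import numFieldNormedType.Exports.

Local Open Scope classical_set_scope.
Local Open Scope ring_scope.

(* The loss is bounded path by path.  If the policy runs out of stock, look at
   its last online acceptance, with s time units remaining: stock was at least
   beta s, so the number of offline customers lost is at most one plus the
   excess of offline arrivals in the last s units over beta s.  If stock is left
   over, look at the last online rejection: stock was below beta s, so the
   leftover is at most the deficit of all arrivals in the last s units below
   beta s.  Since lambda1 < beta < lambda1 + lambda2, the suprema over s of both
   quantities have expectations bounded independently of the horizon: they are
   dominated by sums over integer s of exponential moments of Poisson increments,
   which decay geometrically.  Splitting beta in proportion to lambda1 and lambda2
   bounds the deficit of the two types separately. *)

(** * The loss along a sequence of customers *)

Section PathwiseLoss.
Variable R : realType.
Implicit Types (beta y z p : R) (n a b : nat) (c : @customer R)
  (s : seq (@customer R)).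

Definition hindsight_value (p1 p2 : R) n a b : R :=
  p1 * (minn n a)%:R + p2 * (minn (n - minn n a) b)%:R.

Lemma hindsight_value0 (p1 p2 : R) a b : hindsight_value p1 p2 0 a b = 0.
Proof. by rewrite /hindsight_value !min0n !mulr0 addr0. Qed.

Lemma hindsight_value_offline (p1 p2 : R) n a b :
  hindsight_value p1 p2 n.+1 a.+1 b = p1 + hindsight_value p1 p2 n a b.
Proof.
rewrite /hindsight_value minnSS subSS -addn1 natrD; ring.
Qed.

Lemma hindsight_value_sold_out (p1 p2 : R) n a b :
  (n <= a)%N -> hindsight_value p1 p2 n a b = p1 * n%:R.
Proof.
by move=> na; rewrite /hindsight_value (minn_idPl na) subnn min0n mulr0 addr0.
Qed.

Lemma hindsight_value_online (p1 p2 : R) n a b :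
  (a <= n)%N ->
  hindsight_value p1 p2 n.+1 a b.+1 = p2 + hindsight_value p1 p2 n a b.
Proof.
move=> an; rewrite /hindsight_value (minn_idPr an) (minn_idPr (leqW an)).
by rewrite subSn// minnSS -addn1 natrD; ring.
Qed.

Lemma hindsight_value_leftover (p1 p2 : R) n a b :
  (a + b < n)%N ->
  hindsight_value p1 p2 n a b.+1 = p2 + hindsight_value p1 p2 n a b.
Proof.
move=> abn; rewrite /hindsight_value.
have -> : minn n a = a by lia.
have -> : minn (n - a) b.+1 = b.+1 by lia.
have -> : minn (n - a) b = b by lia.
by rewrite -(addn1 b) natrD; ring.
Qed.

Lemma hindsight_value_scarce (p1 p2 : R) n a b :
  (n <= a + b)%N -> hindsight_value p1 p2 n a b.+1 = hindsight_value p1 p2 n a b.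
Proof.
move=> nab; rewrite /hindsight_value.
by congr (_ + p2 * _%:R); lia.
Qed.

(** The room left below a cap [y] once [k] units are used. The subtraction is done in the reals, so
    [y] need not be an integer. *)
Definition shortfall (y : R) (k : nat) : R := Num.max 0 (y - k%:R).

Lemma shortfall_ge0 y k : 0 <= shortfall y k.
Proof. by rewrite /shortfall le_max lexx. Qed.

Lemma shortfallS y k : k.+1%:R <= y -> shortfall y k = shortfall y k.+1 + 1.
Proof.
move=> ky; rewrite /shortfall !max_r; rewrite -?(addn1 k) ?natrD; first ring.
- by move: ky; rewrite -addn1 natrD; lra.
- by move: ky; rewrite -addn1 natrD; lra.
Qed.

Lemma le_shortfall y k : 0 <= y -> shortfall y k <= y.
Proof. by move=> y0; rewrite /shortfall ge_max y0 gerBl ler0n. Qed.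

Definition later : rel (@customer R) := fun c c' => c'.2 <= c.2.

(* The two shortfalls are potentials: accepting an online customer when the
   offline demand still to come exhausts the stock costs [p1 - p2] but raises
   that excess demand by one, and rejecting one when stock will be left over
   costs [p2] but raises the leftover by one; neither can exceed its cap. *)
Lemma lt_loss_potential (p1 p2 : R) beta y z s n :
  0 <= p2 -> p2 <= p1 -> sorted later s ->
  (forall c, c \in s ->
    (count (fun c' => c'.1 && (c'.2 <= c.2)) s)%:R <= beta * c.2 + y) ->
  (forall c, c \in s ->
    beta * c.2 <= z + (count (fun c' => c'.2 < c.2) s)%:R) ->
  hindsight_value p1 p2 n (count fst s) (count (predC fst) s)
    - lt_revenue p1 p2 beta n s
  <= p1 * shortfall (1 + y) (count fst s - n) + p2 * shortfall z (n - size s).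
Proof.
move=> p20 p21; have p10 : 0 <= p1 by lra.
elim: s n => [|c s IH] n.
  move=> _ _ _ /=; rewrite /hindsight_value minn0 subn0 minn0 !mulr0 addr0 subr0.
  by rewrite addr_ge0// mulr_ge0// shortfall_ge0.
move=> srt hex hdef.
have later_trans : transitive later by move=> u v w; rewrite /later => vu /le_trans; exact.
have /andP[/allP cs srts] : all (later c) s && sorted later s.
  by rewrite -path_sortedE.
have {}cs c' : c' \in s -> c'.2 <= c.2 by exact: cs.
(* Both hypotheses pass to the tail: dropping [c] can only lower the first count, and [c], being
   earliest, never enters the strict count at a later customer. *)
have hex' c' : c' \in s ->
    (count (fun c0 => c0.1 && (c0.2 <= c'.2)) s)%:R <= beta * c'.2 + y.
  move=> c's; apply: le_trans (hex c' _); last by rewrite inE c's orbT.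
  by rewrite ler_nat /= leq_addl.
have hdef' c' : c' \in s ->
    beta * c'.2 <= z + (count (fun c0 => c0.2 < c'.2) s)%:R.
  move=> c's; apply: le_trans (hdef c' _) _; first by rewrite inE c's orbT.
  by rewrite /= ltNge (cs _ c's) add0n.
have {hex} hexc : (count fst s)%:R <= beta * c.2 + y.
  apply: le_trans (hex c (mem_head _ _)); rewrite ler_nat/=.
  rewrite (@eq_in_count _ fst (fun c' => c'.1 && (c'.2 <= c.2))) ?leq_addl//.
  by move=> c' c's /=; rewrite (cs _ c's) andbT.
have {hdef} hdefc : beta * c.2 <= z + (size s)%:R.
  apply: le_trans (hdef c (mem_head _ _)) _; rewrite /= ltxx add0n lerD2l.
  by rewrite ler_nat count_size.
have {}IH n' := IH n' srts hex' hdef'.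
case: n => [|n].
  rewrite hindsight_value0 (_ : lt_revenue _ _ _ _ _ = 0).
    by rewrite subr0 addr_ge0// mulr_ge0// shortfall_ge0.
  by move: (c :: s) => l; elim: l => //= c' l ->; rewrite /lt_accepts.
rewrite /= /lt_accepts /=; case: (boolP c.1) => [c1|/negbTE c1] /=.
  rewrite add1n add0n hindsight_value_offline !subSS.
  by have := IH n; lra.
rewrite add0n add1n; have [hacc|hacc] := leP (beta * c.2) n.+1%:R.
- have := IH n; rewrite subSS; have [an|an] := leqP (count fst s) n.
    rewrite hindsight_value_online//.
    have -> : (count fst s - n.+1 = count fst s - n)%N by lia.
    lra.
  (* Offline demand alone exhausts the stock, so the sale to [c] displaces an offline one; the first
     potential drops by one and pays [p1]. *)
  rewrite !hindsight_value_sold_out// ?(ltnW an)//.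
  have -> : (count fst s - n = (count fst s - n.+1).+1)%N by lia.
  rewrite (shortfallS (1 + y) (count fst s - n.+1)).
    rewrite -(addn1 n) natrD; lra.
  (* Acceptance tests the stock [n.+1] before the sale, while the excess is measured against [n]
     after it; hence the cap [1 + y]. *)
  rewrite -subSn// subSS natrB ?(ltnW an)//.
  by move: hacc; rewrite -addn1 natrD; lra.
- have := IH n.+1; have sE : (size s = count fst s + count (predC fst) s)%N.
    by rewrite count_predC.
  rewrite subSS; have [an|an] := leqP (size s) n.
    rewrite hindsight_value_leftover -?sE//.
    rewrite subSn// (shortfallS z (n - size s)); first by lra.
    rewrite -subSn// natrB ?leqW//; lra.
  (* The remaining customers can absorb all but at most one unit without [c]: if they number more
     than [n], rejecting [c] costs nothing and leaves both potentials unchanged. *)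
  rewrite hindsight_value_scarce -?sE//.
  by have -> : (n.+1 - size s = n - size s)%N by lia.
Qed.

Lemma lt_loss_le (p1 p2 : R) beta y z s n :
  0 <= p2 -> p2 <= p1 -> 0 <= y -> 0 <= z -> sorted later s ->
  (forall c, c \in s ->
    (count (fun c' => c'.1 && (c'.2 <= c.2)) s)%:R <= beta * c.2 + y) ->
  (forall c, c \in s ->
    beta * c.2 <= z + (count (fun c' => c'.2 < c.2) s)%:R) ->
  hindsight_value p1 p2 n (count fst s) (count (predC fst) s)
    - lt_revenue p1 p2 beta n s <= p1 * (1 + y) + p2 * z.
Proof.
move=> p20 p21 y0 z0 srt hex hdef.
apply: le_trans (lt_loss_potential _ _ _ _ _ _ n p20 p21 srt hex hdef) _.
by rewrite lerD// ler_wpM2l ?le_shortfall//; lra.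
Qed.

End PathwiseLoss.

(** * Arrival times and counts *)

Section Arrivals.
Context {Omega : Type} {R : realType}.
Implicit Types (N : R -> Omega -> nat) (w : Omega).

Lemma arrival_time_le N k w (u : R) :
  0 <= u -> (k < N u w)%N -> arrival_time N k w <= u.
Proof.
by move=> u0 kN; apply: ge_inf => //; exists 0 => ? [].
Qed.

Lemma le_arrival_time N k w (v T : R) :
  (forall u u' : R, 0 <= u -> u <= u' -> (N u w <= N u' w)%N) ->
  v <= T -> 0 <= T -> (N v w <= k)%N -> (k < N T w)%N -> v <= arrival_time N k w.
Proof.
(* [T] witnesses that the set is non-empty, so its infimum is not a default value. *)
move=> mono vT T0 Nk kN; apply: lb_le_inf; first by exists T.
move=> u [u0 kNu]; rewrite leNgt; apply/negP => uv.
have := mono _ _ u0 (ltW uv); lia.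
Qed.

(** Indices below [N v w] arrive by time [v], hence with strictly more than [s] time units
    remaining; only the other indices can be counted. *)
Lemma count_late_arrivals_le N w (v s T : R) :
  (forall u u' : R, 0 <= u -> u <= u' -> (N u w <= N u' w)%N) ->
  0 <= v -> v <= T -> v < T - s ->
  (count (fun k => T - arrival_time N k w <= s)%R (iota 0 (N T w))
    <= N T w - N v w)%N.
Proof.
move=> mono v0 vT vs; have NvT := mono _ _ v0 vT.
rewrite -{1}(subnKC NvT) iotaD count_cat add0n.
rewrite (@eq_in_count _ _ pred0) ?count_pred0 ?add0n.
  by rewrite (leq_trans (count_size _ _))// size_iota.
move=> k; rewrite mem_iota /= add0n => kN; apply/negbTE; rewrite -ltNge.
by have := arrival_time_le _ _ _ _ v0 kN; lra.
Qed.

Lemma le_count_late_arrivals N w (v s T : R) :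
  (forall u u' : R, 0 <= u -> u <= u' -> (N u w <= N u' w)%N) ->
  0 <= v -> v <= T -> T - s < v ->
  (N T w - N v w
    <= count (fun k => T - arrival_time N k w < s)%R (iota 0 (N T w)))%N.
Proof.
move=> mono v0 vT vs; have NvT := mono _ _ v0 vT.
rewrite -{2}(subnKC NvT) iotaD count_cat add0n.
rewrite [X in (_ <= _ + X)%N](_ : _ = N T w - N v w)%N ?leq_addl//.
rewrite -[RHS](size_iota (N v w)); apply/eqP; rewrite -all_count.
apply/allP => k; rewrite mem_iota subnKC// => /andP[Nk kN].
by have := le_arrival_time _ _ _ _ _ mono vT (le_trans v0 vT) Nk kN; lra.
Qed.

End Arrivals.

(** * Exponential moments *)

Section Integral.
Context {d : measure_display} {Omega : measurableType d} {R : realType}.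
Variable mu : {measure set Omega -> \bar R}.

(* The regret integrand is never shown to be measurable, so that
   [ge0_le_integral] is not available. *)
Lemma integral_le_ge0 (f g : Omega -> \bar R) :
  (forall w, 0 <= g w)%E -> (forall w, f w <= g w)%E ->
  (\int[mu]_w f w <= \int[mu]_w g w)%E.
Proof.
move=> g0 fg; rewrite integralE.
apply: (@le_trans _ _ (\int[mu]_w (f ^\+)%E w)%E).
  by rewrite geeDl// oppe_le0 integral_ge0.
(* For nonnegative integrands both sides are suprema over simple functions lying below, so
   monotonicity needs no measurability. *)
rewrite !ge0_integralTE//; apply: ereal_sup_le => _ [h hf <-]; exists h => //.
move=> w; apply: (le_trans (hf w)).
by rewrite funeposE ge_max fg g0.
Qed.

Implicit Types f g : Omega -> R.

Lemma integral_add_le f g (a b : R) :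
  measurable_fun setT f -> measurable_fun setT g ->
  (forall w, 0 <= f w) -> (forall w, 0 <= g w) ->
  (\int[mu]_w (f w)%:E <= a%:E)%E -> (\int[mu]_w (g w)%:E <= b%:E)%E ->
  (\int[mu]_w (f w + g w)%:E <= (a + b)%:E)%E.
Proof.
move=> mf mg f0 g0 fa gb; under eq_integral do rewrite EFinD.
rewrite ge0_integralD//; first by rewrite EFinD leeD.
- by move=> w _; rewrite lee_fin.
- exact/measurable_EFinP.
- by move=> w _; rewrite lee_fin.
- exact/measurable_EFinP.
Qed.

Lemma integral_scale_le f (c a : R) :
  0 < c -> measurable_fun setT f -> (forall w, 0 <= f w) ->
  (\int[mu]_w (f w)%:E <= a%:E)%E ->
  (\int[mu]_w (c * f w)%:E <= (c * a)%:E)%E.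
Proof.
move=> c0 mf f0 fa; under eq_integral do rewrite EFinM.
rewrite ge0_integralZl//.
- by rewrite EFinM lee_pmul2l.
- exact/measurable_EFinP.
- by move=> w _; rewrite lee_fin.
- by rewrite lee_fin ltW.
Qed.

End Integral.

Section ExponentialSums.
Context {d : measure_display} {Omega : measurableType d} {R : realType}.
Variable P : probability Omega R.

Lemma sum_geometric_le (q : R) K : 0 <= q -> q < 1 ->
  \sum_(j < K) q ^+ j <= (1 - q)^-1.
Proof.
move=> q0 q1; have q1' : 0 < 1 - q by lra.
rewrite -(ler_pM2l q1') mulfV ?gt_eqF//.
by have := subrX1 q K; have := exprn_ge0 K q0; lra.
Qed.

(** The bound is free of [K], which will grow with the horizon. *)
Lemma integral_exp_sum_le (X : nat -> Omega -> R) (theta M q : R) K :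
  0 < theta -> 0 <= M -> 0 <= q -> q < 1 ->
  (forall j, measurable_fun setT (X j)) ->
  (forall j, (j < K)%N ->
    \int[P]_w (expR (theta * X j w))%:E <= (M * q ^+ j)%:E)%E ->
  (\int[P]_w (theta^-1 * \sum_(j < K) expR (theta * X j w))%:E
    <= (theta^-1 * (M * (1 - q)^-1))%:E)%E.
Proof.
move=> theta0 M0 q0 q1 mX intX.
have mE j : measurable_fun setT (EFin \o (fun w => expR (theta * X j w))).
  apply/measurable_EFinP; apply: measurableT_comp => //.
  exact: measurable_funM.
under eq_integral do rewrite EFinM -sumEFin.
rewrite ge0_integralZl//; last 3 first.
- by apply: emeasurable_sum => j; exact: mE.
- by move=> w _; apply: sume_ge0 => j _; rewrite lee_fin expR_ge0.
- by rewrite lee_fin invr_ge0 ltW.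
rewrite [leRHS]EFinM lee_pmul2l ?lte_fin ?invr_gt0//.
rewrite ge0_integral_sum//; last by move=> j; exact: mE.
apply: (@le_trans _ _ (\sum_(j < K) (M * q ^+ j)%:E)%E).
  by apply: lee_sum => j _; exact: intX.
by rewrite sumEFin lee_fin -mulr_sumr ler_wpM2l ?sum_geometric_le.
Qed.

End ExponentialSums.

Section PoissonIncrements.
Context {d : measure_display} {Omega : measurableType d} {R : realType}.
Variable P : probability Omega R.

(** The terms are [expR (- m)] times those of the exponential series at [m * expR t]. *)
Lemma poisson_pmf_mgf_le (m t : R) : 0 < m ->
  (\sum_(k <oo) (expR (t * k%:R) * poisson_pmf m k)%:E
    <= (expR (m * (expR t - 1)))%:E)%E.
Proof.
move=> m0; have term k : expR (t * k%:R) * poisson_pmf m k =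
    expR (- m) * exp_coeff (m * expR t) k.
  by rewrite /poisson_pmf m0 expRM_natr /exp_coeff/= exprMn; ring.
apply: lime_le.
  apply: is_cvg_nneseries => k _ _.
  by rewrite lee_fin mulr_ge0 ?expR_ge0 ?poisson_pmf_ge0.
apply: nearW => n; rewrite sumEFin lee_fin.
under eq_bigr do rewrite term.
rewrite -mulr_sumr (_ : m * (expR t - 1) = - m + m * expR t); last by ring.
rewrite expRD ler_wpM2l ?expR_ge0//.
apply: nondecreasing_cvgn_le; last exact: is_cvg_series_exp_coeff.
apply: nondecreasing_series => k _ _.
by rewrite exp_coeff_ge0// mulr_ge0 ?expR_ge0// ltW.
Qed.

Lemma poisson_process_mgf_le lambda N (t u v : R) :
  poisson_process P lambda N -> 0 < lambda -> 0 <= u -> u <= v ->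
  (\int[P]_w (expR (t * (N v w - N u w)%:R))%:E
    <= (expR (lambda * (v - u) * (expR t - 1)))%:E)%E.
Proof.
move=> PN lambda0 u0; rewrite le_eqVlt => /orP[/eqP <-|uv].
  (* An empty interval is treated apart, since the Poisson law is given only for [u < v]. *)
  under eq_integral do rewrite subnn mulr0 expR0.
  by rewrite integral_cst// [X in (_ * X)%E](@probability_setT _ _ _ P) mul1e subrr mulr0 mul0r expR0.
have v0 : 0 <= v by lra.
pose D w := (N v w - N u w)%N.
have mD : measurable_fun setT D.
  by apply: measurable_fun_subn; exact: (pp_measurable PN).
have mDk k : measurable (D @^-1` [set k]) by rewrite -[X in measurable X]setTI; exact: mD.
have mE : measurable_fun setT (EFin \o (fun w => expR (t * (D w)%:R))).
  apply/measurable_EFinP.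
  by apply: (@measurableT_comp _ _ _ _ _ _ (fun k : nat => expR (t * k%:R))).
have DT : \bigcup_k (D @^-1` [set k]) = setT.
  by apply/seteqP; split=> // w _; exists (D w).
(* Cutting the space by the value of the increment turns the integral into the series for the
   Poisson law. *)
rewrite -DT ge0_integral_bigcup//; last 2 first.
- by rewrite DT.
- exact: trivIset_preimage1.
rewrite (eq_eseriesr (g := fun k =>
    (expR (t * k%:R) * poisson_pmf (lambda * (v - u)) k)%:E)).
  by apply: poisson_pmf_mgf_le; rewrite mulr_gt0// subr_gt0.
move=> k _; rewrite (eq_integral (cst (expR (t * k%:R))%:E)).
  by rewrite integral_cst// EFinM -(pp_poisson_increments PN).
by move=> w /set_mem /= <-.
Qed.

End PoissonIncrements.

(** A smooth substitute for the maximum of the [x j], from [theta * x <= expR (theta * x)]. *)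
Lemma le_exp_sum (R : realType) (theta : R) (x : nat -> R) K j :
  0 < theta -> (j < K)%N ->
  x j <= theta^-1 * \sum_(i < K) expR (theta * x i).
Proof.
move=> theta0 jK; rewrite -(ler_pM2l theta0) mulVKf ?gt_eqF//.
rewrite (bigD1 (Ordinal jK))//=.
have := expR_ge1Dx (theta * x j).
suff : 0 <= \sum_(i < K | i != Ordinal jK) expR (theta * x i) by lra.
by apply: sumr_ge0 => i _; exact: expR_ge0.
Qed.

Lemma poisson_process_affine_mgf_le {d : measure_display}
    {Omega : measurableType d} {R : realType} (P : probability Omega R)
    lambda N (a b u v : R) :
  poisson_process P lambda N -> 0 < lambda -> 0 <= u -> u <= v ->
  (\int[P]_w (expR (a * (N v w - N u w)%:R + b))%:E
    <= (expR (lambda * (v - u) * (expR a - 1) + b))%:E)%E.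
Proof.
move=> PN lambda0 u0 uv; have v0 : 0 <= v by lra.
under eq_integral do rewrite expRD mulrC EFinM.
rewrite ge0_integralZl//.
- rewrite expRD [in leRHS]mulrC [leRHS]EFinM lee_pmul2l ?lte_fin ?expR_gt0//.
  exact: poisson_process_mgf_le PN _ _ _.
- apply/measurable_EFinP; apply: (@measurableT_comp _ _ _ _ _ _
    (fun k : nat => expR (a * k%:R)) _ (fun w => (N v w - N u w)%N)) => //.
  by apply: measurable_fun_subn; exact: (pp_measurable PN).
Qed.

Lemma measurable_increment {d : measure_display}
    {Omega : measurableType d} {R : realType} (P : probability Omega R)
    lambda N (u v : R) :
  poisson_process P lambda N -> 0 <= u -> 0 <= v ->
  measurable_fun setT (fun w => (N v w - N u w)%:R : R).
Proof.
move=> PN u0 v0; apply: (@measurableT_comp _ _ _ _ _ _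
    (fun k : nat => k%:R : R) _ (fun w => (N v w - N u w)%N)) => //.
by apply: measurable_fun_subn; exact: (pp_measurable PN).
Qed.

(** * Choice of the exponential rate [theta] *)

Section ExponentialRates.
Variables (R : realType) (lambda beta : R).

(** To first order [expR theta - 1] is [theta], so a small [theta] works. Explicitly,
    [expR theta * (1 - theta) <= 1], and [theta] is chosen so that [beta * (1 - theta)] is the
    midpoint of [lambda] and [beta]. *)
Lemma exists_excess_rate : 0 < lambda -> lambda < beta ->
  exists2 theta : R, 0 < theta & lambda * (expR theta - 1) < theta * beta.
Proof.
move=> lambda0 lb; have beta0 : 0 < beta by lra.
pose theta := (beta - lambda) / (2 * beta).
have theta0 : 0 < theta by rewrite divr_gt0; lra.
have bt : beta * (1 - theta) = (beta + lambda) / 2 by rewrite /theta; field; lra.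
have theta1 : 0 < 1 - theta by rewrite -(pmulr_rgt0 _ beta0) bt; lra.
exists theta => //; rewrite -(ltr_pM2r theta1).
have := expR_ge1Dx (- theta); rewrite -(ler_pM2l (expR_gt0 theta)).
rewrite -expRD subrr expR0 => h.
apply: (@le_lt_trans _ _ (lambda * theta)).
  have -> : lambda * (expR theta - 1) * (1 - theta)
      = lambda * (expR theta * (1 - theta) - (1 - theta)) by ring.
  by rewrite ler_pM2l//; lra.
by rewrite -mulrA bt mulrC ltr_pM2l//; lra.
Qed.

Lemma exists_deficit_rate : 0 < beta -> beta < lambda ->
  exists2 theta : R, 0 < theta & theta * beta < lambda * (1 - expR (- theta)).
Proof.
move=> beta0 bl; have lambda0 : 0 < lambda by lra.
pose theta := (lambda - beta) / (2 * beta).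
have theta0 : 0 < theta by rewrite divr_gt0; lra.
have bt : beta * (1 + theta) = (beta + lambda) / 2 by rewrite /theta; field; lra.
have theta1 : 0 < 1 + theta by lra.
exists theta => //; rewrite -(ltr_pM2r theta1).
(* This yields [expR (- theta) * (1 + theta) <= 1]; again [beta * (1 + theta)] is the midpoint. *)
have := expR_ge1Dx theta; rewrite -(ler_pM2l (expR_gt0 (- theta))).
rewrite -expRD addNr expR0 => h.
apply: (@lt_le_trans _ _ (lambda * theta)).
  by rewrite -mulrA bt mulrC ltr_pM2r//; lra.
have -> : lambda * (1 - expR (- theta)) * (1 + theta)
    = lambda * (1 + theta - expR (- theta) * (1 + theta)) by ring.
by rewrite ler_pM2l//; lra.
Qed.

End ExponentialRates.

(** * Uniform bounds on the fluctuations of a Poisson process *)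

(* Here the supremum over [s] is discretised: when [j <= s < j + 1], monotonicity
   of the paths compares the last [s] time units with the last [j + 1] (for the
   excess) or [j - 1] (for the deficit). *)
Section Fluctuations.
Variables (R : realType) (lambda beta : R).
Hypothesis lambda0 : 0 < lambda.

(** [C] is fixed before the probability space and the horizon, which is the uniformity that the
    regret bound needs. *)
Lemma poisson_excess : lambda < beta ->
  exists2 C : R, 0 <= C &
  forall (d : measure_display) (Omega : measurableType d)
    (P : probability Omega R) (N : R -> Omega -> nat),
    poisson_process P lambda N -> forall T : R, 0 <= T ->
  exists G : Omega -> R,
    [/\ measurable_fun setT G, forall w, 0 <= G w,
        (\int[P]_w (G w)%:E <= C%:E)%E &
        forall w s, 0 <= s -> s <= T ->
          (count (fun k => T - arrival_time N k w <= s)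
            (iota 0 (N T w)))%:R <= beta * s + G w].
Proof.
move=> lb; have beta0 := lt_trans lambda0 lb.
have [theta theta0 rate] := exists_excess_rate _ _ _ lambda0 lb.
pose e := lambda * (expR theta - 1); pose q := expR (e - theta * beta).
have e0 : 0 <= e.
  by rewrite mulr_ge0 ?(ltW lambda0)//; have := expR_ge1Dx theta; lra.
have q1 : q < 1 by rewrite expR_lt1 subr_lt0.
(* The moment of [X j] is at most [expR (e * (j + 1) - theta * beta * j)], that is
   [expR e * q ^+ j]. *)
exists (theta^-1 * (expR e * (1 - q)^-1)).
  by rewrite !mulr_ge0 ?expR_ge0 ?invr_ge0//; lra.
move=> d Omega P N PN T T0.
pose v j : R := Num.max 0 (T - j.+1%:R).
have v0 j : 0 <= v j by rewrite le_max lexx.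
have vT j : v j <= T by rewrite ge_max T0 gerBl ler0n.
pose X j w : R := (N T w - N (v j) w)%:R - beta * j%:R.
have mX j : measurable_fun setT (X j).
  by apply: measurable_funB => //; exact: measurable_increment PN _ _.
pose K := (Num.truncn T).+1.
exists (fun w => theta^-1 * \sum_(j < K) expR (theta * X j w)); split.
- apply: measurable_funM => //; apply: measurable_sum => j.
  by apply: measurableT_comp => //; exact: measurable_funM.
- move=> w; apply: mulr_ge0; first by rewrite invr_ge0 ltW.
  by apply: sumr_ge0 => j _; exact: expR_ge0.
- apply: integral_exp_sum_le; rewrite ?expR_ge0// => j _.
  under eq_integral do rewrite mulrBr.
  apply: le_trans (poisson_process_affine_mgf_le _ _ _ _ _ _ _ PN _ _ _) _ => //.
  rewrite lee_fin -expRM_natr -expRD ler_expR.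
  have : e * (T - v j) <= e * j.+1%:R.
    by rewrite ler_wpM2l// lerBlDr -lerBlDl le_max lexx orbT.
  by rewrite -addn1 natrD /e; lra.
move=> w s s0 sT.
have /andP[js sj] := truncn_itv s0; set j := Num.truncn s in js sj.
have jK : (j < K)%N by rewrite ltnS truncn_ge_nat// (le_trans js).
apply: (@le_trans _ _ (beta * s + X j w)); last first.
  by rewrite lerD2l; exact: (le_exp_sum _ _ (fun i => X i w)).
apply: (@le_trans _ _ (N T w - N (v j) w)%:R); last first.
  by have := ler_wpM2l (ltW beta0) js; rewrite /X; lra.
rewrite ler_nat; have [vs|sv] := ltP (v j) (T - s).
  by apply: count_late_arrivals_le => //; exact: (pp_nondecreasing PN).
(* As [s < j + 1], this case arises only when the window is clipped at the start of the horizon; it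
   then holds every arrival. *)
have -> : v j = 0.
  by apply: max_l; move: sv; rewrite /v le_max => /orP[|]; lra.
by rewrite (pp_start PN) subn0 (leq_trans (count_size _ _))// size_iota.
Qed.

Lemma poisson_deficit : 0 < beta -> beta < lambda ->
  exists2 C : R, 0 <= C &
  forall (d : measure_display) (Omega : measurableType d)
    (P : probability Omega R) (N : R -> Omega -> nat),
    poisson_process P lambda N -> forall T : R, 0 <= T ->
  exists G : Omega -> R,
    [/\ measurable_fun setT G, forall w, 0 <= G w,
        (\int[P]_w (G w)%:E <= C%:E)%E &
        forall w s, 0 <= s -> s <= T ->
          beta * s <= G w + (count (fun k => T - arrival_time N k w < s)
            (iota 0 (N T w)))%:R].
Proof.
move=> beta0 bl.
have [theta theta0 rate] := exists_deficit_rate _ _ _ beta0 bl.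
pose e := lambda * (1 - expR (- theta)); pose q := expR (theta * beta - e).
have q1 : q < 1 by rewrite expR_lt1 subr_lt0.
(* Here the exponent is at most [theta * beta * (j + 1) - e * (j - 1)]. *)
exists (theta^-1 * (expR (theta * beta + e) * (1 - q)^-1)).
  by rewrite !mulr_ge0 ?expR_ge0 ?invr_ge0//; lra.
move=> d Omega P N PN T T0.
pose v j : R := Num.max 0 (T - j.-1%:R).
have v0 j : 0 <= v j by rewrite le_max lexx.
have vT j : v j <= T by rewrite ge_max T0 gerBl ler0n.
pose X j w : R := beta * j.+1%:R - (N T w - N (v j) w)%:R.
have mX j : measurable_fun setT (X j).
  by apply: measurable_funB => //; exact: measurable_increment PN _ _.
pose K := (Num.truncn T).+1.
have vE j : (j < K)%N -> v j = T - j.-1%:R.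
  rewrite ltnS truncn_ge_nat// => jT; apply: max_r; rewrite subr_ge0.
  by apply: le_trans jT; rewrite ler_nat leq_pred.
exists (fun w => theta^-1 * \sum_(j < K) expR (theta * X j w)); split.
- apply: measurable_funM => //; apply: measurable_sum => j.
  by apply: measurableT_comp => //; exact: measurable_funM.
- move=> w; apply: mulr_ge0; first by rewrite invr_ge0 ltW.
  by apply: sumr_ge0 => j _; exact: expR_ge0.
- apply: integral_exp_sum_le; rewrite ?expR_ge0// => j jK.
  under eq_integral do rewrite mulrBr addrC -mulNr.
  apply: le_trans (poisson_process_affine_mgf_le _ _ _ _ _ _ _ PN _ _ _) _ => //.
  rewrite lee_fin -expRM_natr -expRD ler_expR vE//.
  have e0 : 0 <= e by have := mulr_gt0 theta0 beta0; rewrite /e; lra.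
  have : e * (j%:R - 1) <= e * j.-1%:R.
    by rewrite ler_wpM2l// lerBlDr natr1 ler_nat; lia.
  by rewrite -(addn1 j) natrD /e; lra.
move=> w s s0 sT.
have /andP[js sj] := truncn_itv s0; set j := Num.truncn s in js sj.
have jK : (j < K)%N by rewrite ltnS truncn_ge_nat// (le_trans js).
apply: (@le_trans _ _ (X j w + (N T w - N (v j) w)%:R)).
  by rewrite subrK ler_pM2l// ltW.
apply: lerD; first exact: (le_exp_sum _ _ (fun i => X i w)).
(* At [j = 0] the predecessor [j.-1] is [0], so the window is empty; otherwise [j.-1 < s] gives the
   strict count. *)
rewrite ler_nat; have [j0|j0] := posnP j.
  by rewrite vE// j0 subr0 subnn.
apply: le_count_late_arrivals => //; first exact: (pp_nondecreasing PN).
rewrite vE// ltrD2l ltrN2; apply: lt_le_trans js.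
by rewrite ltr_nat prednK.
Qed.

End Fluctuations.

(** * The regret bound *)

Section Customers.
Context {Omega : Type} {R : realType}.
Variables (N1 N2 : R -> Omega -> nat) (T : R) (w : Omega).
Hypothesis T0 : 0 <= T.

Lemma count_customers (a : pred (@customer R)) :
  count a (customers N1 N2 T w) =
  (count (fun k => a (true, (T - arrival_time N1 k w)%R)) (iota 0 (N1 T w)) +
   count (fun k => a (false, (T - arrival_time N2 k w)%R)) (iota 0 (N2 T w)))%N.
Proof.
by rewrite /customers (permP (permEl (perm_sort _ _))) count_cat !count_map.
Qed.

Lemma sorted_customers : sorted (later R) (customers N1 N2 T w).
Proof. by apply: sort_sorted => c c'; exact: le_total. Qed.

Lemma customers_of_time off (N : R -> Omega -> nat) c :
  N 0 w = 0%N -> (forall u u' : R, 0 <= u -> u <= u' -> (N u w <= N u' w)%N) ->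
  c \in customers_of off N T w -> 0 <= c.2 /\ c.2 <= T.
Proof.
move=> start mono /mapP[k]; rewrite mem_iota add0n => /= kN -> /=.
have le := arrival_time_le _ _ _ _ T0 kN.
have := le_arrival_time _ _ _ 0 _ mono T0 T0.
by rewrite start => /(_ k isT kN) ge; split; lra.
Qed.

End Customers.

Theorem theorem1 (R : realType) (lambda1 lambda2 p1 p2 : R)
    (hlambda1 : 0 < lambda1) (hlambda2 : 0 < lambda2)
    (hp2 : 0 < p2) (hp : p2 < p1)
    (beta : R) (hbeta1 : lambda1 < beta) (hbeta2 : beta < lambda1 + lambda2) :
  exists rho : R, 0 < rho /\
    forall (d : measure_display) (Omega : measurableType d)
      (P : probability Omega R) (N1 N2 : R -> Omega -> nat),
      poisson_process P lambda1 N1 ->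
      poisson_process P lambda2 N2 ->
      independent_processes P N1 N2 ->
      forall (n : nat) (alpha : R), (0 < n)%N -> 0 < alpha ->
        (regret P N1 N2 p1 p2 beta n (n%:R / alpha) <= rho%:E)%E.
Proof.
have lambda0 : 0 < lambda1 + lambda2 by lra.
have beta0 : 0 < beta by lra.
(* Since [r < 1], each share [r * lambda1], [r * lambda2] of [beta] stays strictly below the rate of
   its own type. *)
pose r := beta / (lambda1 + lambda2).
have r0 : 0 < r by rewrite divr_gt0.
have r1 : r < 1 by rewrite ltr_pdivrMr// mul1r.
have betaE : beta = r * lambda1 + r * lambda2.
  by rewrite -mulrDr divfK ?gt_eqF.
have [C1 C10 excess] := poisson_excess _ _ _ hlambda1 hbeta1.
have [C2 C20 deficit1] : _ :=
  poisson_deficit _ lambda1 (r * lambda1) hlambda1 (mulr_gt0 r0 hlambda1)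
    (ltac:(by rewrite gtr_pMl)).
have [C3 C30 deficit2] : _ :=
  poisson_deficit _ lambda2 (r * lambda2) hlambda2 (mulr_gt0 r0 hlambda2)
    (ltac:(by rewrite gtr_pMl)).
exists (p1 * (1 + C1) + p2 * (C2 + C3)); split.
  by apply: ltr_wpDr; [rewrite mulr_ge0//; lra|rewrite mulr_gt0//; lra].
move=> d Omega P N1 N2 PN1 PN2 _ n alpha n0 alpha0.
set T := n%:R / alpha; have T0 : 0 <= T by rewrite divr_ge0// ltW.
have [G1 [mG1 G10 intG1 G1P]] := excess _ _ _ _ PN1 _ T0.
have [G2 [mG2 G20 intG2 G2P]] := deficit1 _ _ _ _ PN1 _ T0.
have [G3 [mG3 G30 intG3 G3P]] := deficit2 _ _ _ _ PN2 _ T0.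
have pathwise w : hindsight_revenue p1 p2 n N1 N2 T w
    - lt_revenue p1 p2 beta n (customers N1 N2 T w)
    <= p1 * (1 + G1 w) + p2 * (G2 w + G3 w).
  have time c : c \in customers N1 N2 T w -> 0 <= c.2 /\ c.2 <= T.
    rewrite mem_sort mem_cat => /orP[]; apply: customers_of_time => //.
    - exact: (pp_start PN1).
    - exact: (pp_nondecreasing PN1).
    - exact: (pp_start PN2).
    - exact: (pp_nondecreasing PN2).
  have -> : hindsight_revenue p1 p2 n N1 N2 T w =
      hindsight_value R p1 p2 n (count fst (customers N1 N2 T w))
        (count (predC fst) (customers N1 N2 T w)).
    rewrite !count_customers /= !count_predT !count_pred0 !size_iota.
    by rewrite addn0 add0n.
  apply: lt_loss_le; rewrite ?(ltW hp2) ?(ltW hp) ?addr_ge0 ?G10//.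
  - exact: sorted_customers.
  - move=> c /time[c0 cT]; rewrite count_customers/= count_pred0 addn0.
    exact: G1P.
  - move=> c /time[c0 cT]; rewrite count_customers/= natrD.
    have := G2P w _ c0 cT; have := G3P w _ c0 cT; rewrite betaE; lra.
rewrite /regret unlock.
have G0 w : 0 <= p1 * (1 + G1 w) + p2 * (G2 w + G3 w).
  have := G10 w; have := G20 w; have := G30 w => *.
  by rewrite addr_ge0// mulr_ge0//; lra.
apply: (@le_trans _ _
  (\int[P]_w (p1 * (1 + G1 w) + p2 * (G2 w + G3 w))%:E)%E).
  by apply: integral_le_ge0 => w; rewrite lee_fin.
have p10 : 0 < p1 := lt_trans hp2 hp.
have int1 : (\int[P]_w (1 : R)%:E <= 1%:E)%E.
  by rewrite integral_cst// [X in (_ * X)%E](@probability_setT _ _ _ P) mul1e.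
have G10' w : 0 <= 1 + G1 w by rewrite addr_ge0.
have G230 w : 0 <= G2 w + G3 w by rewrite addr_ge0.
have mG1' : measurable_fun setT (fun w => 1 + G1 w) by exact: measurable_funD.
have mG23 : measurable_fun setT (fun w => G2 w + G3 w) by exact: measurable_funD.
apply: (integral_add_le P (fun w => p1 * (1 + G1 w))
  (fun w => p2 * (G2 w + G3 w))).
- exact: measurable_funM.
- exact: measurable_funM.
- by move=> w; apply: mulr_ge0 => //; exact: ltW.
- by move=> w; apply: mulr_ge0 => //; exact: ltW.
- apply: integral_scale_le => //.
  by apply: (integral_add_le P (fun=> 1) G1).
- by apply: integral_scale_le => //; exact: integral_add_le.
Qed.
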